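(* Let $G$ be a group with identity $e$ and let $R=\bigoplus_{g\in G}R_g$ be a $G$-graded commutative ring. Then $R$ is a Gelfand graded ring if and only if the subring $R_e$ is a Gelfand ring.
   Context: A commutative ring $R$ with unit is $G$-graded if $R=\bigoplus_{g\in G}R_g$ with additive subgroups $R_g$ satisfying $R_gR_{g'}\subseteq R_{gg'}$; $h(R)=\bigcup_{g\in G}R_g$ is the set of homogeneous elements. An ideal $I$ is graded if $I=\bigoplus_{g\in G}(I\cap R_g)$. A homogeneous prime ideal is a graded ideal $P\neq R$ such that for all $r,s\in h(R)$, $rs\in P$ implies $r\in P$ or $s\in P$. A graded maximal ideal is a graded ideal that is maximal among proper graded ideals. $R$ is called a Gelfand ($G$-)graded ring if every homogeneous prime ideal of $R$ is contained in a unique graded maximal ideal of $R$. A commutative ring (ungraded) is a Gelfand ring if every prime ideal is contained in a unique maximal ideal. *)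

(* Defs.v *)
From HB Require Import structures.
From mathcomp Require Import all_boot all_order all_algebra.
From mathcomp Require Import boolp classical_sets.

Set Implicit Arguments.
Unset Strict Implicit.
Unset Printing Implicit Defensive.

Import GRing.Theory.
Local Open Scope classical_set_scope.
Local Open Scope ring_scope.

(* The ideals of ring_quotient.v are not used: they live in an nzRingType and
   are proper by definition, whereas rings here may be zero (comPzRingType). *)
Section Ideals.
Variable R : comPzRingType.
Implicit Types I P M : set R.

Definition is_ideal I : Prop :=
  zmod_closed (mem I) /\ (forall a x, I x -> I (a * x)).

Definition is_prime_ideal P : Prop :=
  [/\ is_ideal P, P <> [set: R] & forall x y, P (x * y) -> P x \/ P y].

Definition is_maximal_ideal M : Prop :=
  [/\ is_ideal M, M <> [set: R] &
      forall J : set R, is_ideal J -> J <> [set: R] -> M `<=` J -> J = M].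

End Ideals.

Definition gelfand_ring (R : comPzRingType) : Prop :=
  forall P : set R, is_prime_ideal P ->
    exists! M : set R, is_maximal_ideal M /\ P `<=` M.

(* A is the internal direct sum of the subgroups F i: its elements are the
   finite sums of elements of the F i, and such a sum over distinct indices
   vanishes only if all its terms do. *)
Definition internal_direct_sum (V : zmodType) (I : choiceType)
    (A : set V) (F : I -> set V) : Prop :=
  (forall v, A v <-> exists (s : seq I) (x : I -> V),
     [/\ uniq s, {in s, forall i, F i (x i)} & v = \sum_(i <- s) x i]) /\
  (forall (s : seq I) (x : I -> V), uniq s -> {in s, forall i, F i (x i)} ->
     \sum_(i <- s) x i = 0 -> {in s, forall i, x i = 0}).

Record grading (G : groupType) (R : comPzRingType) := Grading {
  component :> G -> set R;
  component_zmod : forall g, zmod_closed (mem (component g));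
  component_mul : forall g h x y,
    component g x -> component h y -> component (g * h)%g (x * y);
  component_sum : internal_direct_sum [set: R] component
}.

Section GradedIdeals.
Variables (G : groupType) (R : comPzRingType) (gr : grading G R).
Implicit Types I P M : set R.

Definition homogeneous : set R := \bigcup_(g in [set: G]) gr g.

Definition is_graded_ideal I : Prop :=
  is_ideal I /\ internal_direct_sum I (fun g => I `&` gr g).

Definition is_homogeneous_prime_ideal P : Prop :=
  [/\ is_graded_ideal P, P <> [set: R] &
      forall r s, homogeneous r -> homogeneous s -> P (r * s) -> P r \/ P s].

Definition is_graded_maximal_ideal M : Prop :=
  [/\ is_graded_ideal M, M <> [set: R] &
      forall J : set R,
        is_graded_ideal J -> J <> [set: R] -> M `<=` J -> J = M].

Definition gelfand_graded_ring : Prop :=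
  forall P : set R, is_homogeneous_prime_ideal P ->
    exists! M : set R, is_graded_maximal_ideal M /\ P `<=` M.

End GradedIdeals.

Section IdentityComponent.
Variables (G : groupType) (R : comPzRingType) (gr : grading G R).

Lemma component0 g : gr g 0.
Proof. by have [/set_mem] := component_zmod gr g. Qed.

Lemma componentB g x y : gr g x -> gr g y -> gr g (x - y).
Proof.
have [_ H] := component_zmod gr g => xg yg.
by apply/set_mem/H; exact/mem_set.
Qed.

Lemma component1 : gr 1%g 1.
Proof.
have [dec indep] := component_sum gr.
have [s0 [x0 [us0 x0P e0]]] := (dec 1).1 Logic.I.
pose s := undup (1%g :: s0).
pose x i := if i \in s0 then x0 i else 0.
have us : uniq s by exact: undup_uniq.
have s1 : 1%g \in s by rewrite mem_undup mem_head.
have xP i : gr i (x i).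
  by rewrite /x; case: ifP => [/x0P //|_]; exact: component0.
have e1 : 1 = \sum_(i <- s) x i.
  rewrite e0 /s /=; case: ifP => si.
    by rewrite undup_id //; apply: eq_big_seq => i si'; rewrite /x si'.
  rewrite big_cons /x si add0r undup_id //.
  by apply: eq_big_seq => i si'; rewrite si'.
have key g y : gr g y -> y = x 1%g * y.
  move=> yg; pose z j := (if j == g then y else 0) - x (j * g^-1)%g * y.
  have zP j : gr j (z j).
    apply: componentB; first by case: eqP => [->//|_]; exact: component0.
    by have := component_mul (xP (j * g^-1)%g) yg; rewrite mulgVK.
  pose t := [seq (i * g)%g | i <- s].
  have ut : uniq t by rewrite map_inj_uniq //; exact: mulIg.
  have gt : g \in t by apply/mapP; exists 1%g; rewrite // mul1g.
  have zt : \sum_(j <- t) z j = 0.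
    rewrite big_split /= sumrN (bigD1_seq g) //= eqxx.
    rewrite big1 ?addr0 => [|j /negPf -> //].
    rewrite big_map (eq_bigr (fun i => x i * y)).
      by rewrite -mulr_suml -e1 mul1r subrr.
    by move=> i _; rewrite mulgK.
  have := indep t z ut (fun j _ => zP j) zt g gt.
  by rewrite /z eqxx mulgV => /subr0_eq.
suff -> : (1 : R) = x 1%g by exact: xP.
rewrite -[RHS]mulr1 {2}e1 mulr_sumr e1.
by apply: eq_bigr => i _; exact: key (xP i).
Qed.

Definition identity_component : {pred R} := [pred r | r \in gr 1%g].

Lemma identity_component_subring : subring_closed identity_component.
Proof.
split=> [|x y /set_mem xe /set_mem ye|x y /set_mem xe /set_mem ye].
- by apply/mem_set; exact: component1.
- by apply/mem_set; exact: componentB.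
- apply/mem_set; rewrite -[1%g in X in gr X]mulg1.
  exact: component_mul.
Qed.

Record identity_subring : Type := IdentitySubring {
  identity_val :> R;
  _ : identity_val \in identity_component
}.

HB.instance Definition _ := [isSub for identity_val].
HB.instance Definition _ := [Choice of identity_subring by <:].
HB.instance Definition _ :=
  GRing.SubChoice_isSubComPzRing.Build R identity_component identity_subring
    identity_component_subring.

End IdentityComponent.

(* Main.v *)
(* Write a_e for the component of a in R_e and, for an ideal I of R_e, put
   E(I) := { r | (r t)_e \in I for all t }. This is a graded ideal with
   E(I) \cap R_e = I, and it is the largest one: J <= E(I) as soon as J is
   graded and J \cap R_e <= I. Hence contraction to R_e and E are inverse
   bijections between graded maximal ideals of R and maximal ideals of R_e.
   Both preserve primeness, and a graded ideal P lies in E(m) if and only if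
   P \cap R_e <= m, so uniqueness transfers in both directions. *)

Require Import Defs.
From mathcomp Require Import all_boot all_order all_algebra.
From mathcomp Require Import boolp classical_sets.

Set Implicit Arguments.
Unset Strict Implicit.
Unset Printing Implicit Defensive.

Import GRing.Theory.
Local Open Scope classical_set_scope.
Local Open Scope ring_scope.

(** * Ideals of a commutative ring, in elementwise form *)

Section IdealTheory.
Variable R : comPzRingType.
Implicit Types I : set R.

Lemma is_idealP I :
  is_ideal I <-> [/\ I 0, forall x y, I x -> I y -> I (x - y) &
                     forall a x, I x -> I (a * x)].
Proof.
split=> [[[/set_mem I0 IB] IM]|[I0 IB IM]]; split=> //.
- by move=> x y Ix Iy; apply/set_mem/IB; exact/mem_set.
- split=> [|x y /set_mem Ix /set_mem Iy]; first exact/mem_set.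
  by apply/mem_set/IB.
Qed.

Lemma ideal_sum I (J : Type) (s : seq J) (P : pred J) (F : J -> R) :
  is_ideal I -> (forall j, P j -> I (F j)) -> I (\sum_(j <- s | P j) F j).
Proof.
case/is_idealP=> I0 IB _ IF; apply: big_ind => // x y Ix Iy.
by rewrite -[y]opprK; apply: (IB _ _ Ix); rewrite -sub0r; exact: IB.
Qed.

Lemma ideal_properP I : is_ideal I -> (I <> [set: R] <-> ~ I 1).
Proof.
case/is_idealP=> _ _ IM; split=> [+ I1|I1 IT]; last by apply: I1; rewrite IT.
by apply; apply/seteqP; split=> // x _; rewrite -[x]mulr1; exact: IM.
Qed.

End IdealTheory.

(** * Homogeneous components of an element *)

Section Projections.
Variables (G : groupType) (R : comPzRingType) (gr : grading G R).

(** The family [x] is total and zero off [s], so that decompositions with different supports compare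
    pointwise. *)
Definition decomposition (r : R) (s : seq G) (x : G -> R) : Prop :=
  [/\ uniq s, forall i, gr i (x i), forall i, i \notin s -> x i = 0 &
      r = \sum_(i <- s) x i].

Lemma decomposition_exists r : exists x s, decomposition r s x.
Proof.
have [dec _] := component_sum gr.
have [s [x [us xP ->]]] := (dec r).1 Logic.I.
exists (fun i => if i \in s then x i else 0), s; split=> // [i|i /negPf->//|].
  by case: ifP => [/xP //|_]; exact: component0.
by apply: eq_big_seq => i ->.
Qed.

Lemma decomposition_sum r s s' x :
  decomposition r s x -> uniq s' -> {subset s <= s'} ->
  r = \sum_(i <- s') x i.
Proof.
case=> us _ x0 -> us' ss'.
rewrite -[RHS](@big_rmcond_in _ _ _ _ _ (mem s)) /= => [|i _ /x0 //].
rewrite -[RHS]big_filter; apply: perm_big; apply: uniq_perm => //.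
  exact: filter_uniq.
by move=> i; rewrite mem_filter; case: (boolP (i \in s)) => //= /ss' ->.
Qed.

Lemma decomposition_unique r s s' x x' :
  decomposition r s x -> decomposition r s' x' -> x =1 x'.
Proof.
(* Over a common support the difference of the two families sums to 0, so independence applies;
   including [i] covers indices outside both supports. *)
move=> d d' i; pose t := undup (i :: s ++ s').
have ut : uniq t by exact: undup_uniq.
have st : {subset s <= t}.
  by move=> j js; rewrite mem_undup inE mem_cat js orbT.
have st' : {subset s' <= t}.
  by move=> j js; rewrite mem_undup inE mem_cat js !orbT.
have it : i \in t by rewrite mem_undup mem_head.
have e := decomposition_sum d ut st; have e' := decomposition_sum d' ut st'.
case: d d' => [_ xP _ _] [_ xP' _ _].
apply/subr0_eq.
apply: ((component_sum gr).2 t (fun j => x j - x' j) ut _ _ i it).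
  by move=> j _; exact: componentB.
by rewrite big_split /= sumrN -e -e' subrr.
Qed.

Definition proj (g : G) (r : R) : R := sval (cid (decomposition_exists r)) g.

Lemma projP r : exists s, decomposition r s (proj^~ r).
Proof. exact: (svalP (cid (decomposition_exists r))). Qed.

Lemma proj_component g r : gr g (proj g r).
Proof. by have [s []] := projP r. Qed.

Lemma proj_eq r s x : decomposition r s x -> forall g, proj g r = x g.
Proof. by move=> d g; have [t /decomposition_unique/(_ d)] := projP r. Qed.

Lemma projB g r r' : proj g (r - r') = proj g r - proj g r'.
Proof.
have [s d] := projP r; have [s' d'] := projP r'.
pose t := undup (s ++ s').
have ut : uniq t by exact: undup_uniq.
have st : {subset s <= t} by move=> j js; rewrite mem_undup mem_cat js.
have st' : {subset s' <= t} by move=> j js; rewrite mem_undup mem_cat js orbT.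
apply: (@proj_eq _ t (fun g => proj g r - proj g r')); split=> //.
- by move=> i; apply: componentB; exact: proj_component.
- move=> i; rewrite mem_undup mem_cat negb_or => /andP[si si'].
  by case: d d' => [_ _ /(_ _ si)-> _] [_ _ /(_ _ si')-> _]; rewrite subrr.
- rewrite big_split /= sumrN -(decomposition_sum d) //.
  by rewrite -(decomposition_sum d').
Qed.

Lemma proj_id g r : gr g r -> proj g r = r.
Proof.
move=> rg; rewrite (@proj_eq _ [:: g] (fun h => if h == g then r else 0)).
  by rewrite eqxx.
split=> // [i|i|]; last by rewrite big_seq1 eqxx.
- by case: eqP => [->//|_]; exact: component0.
- by rewrite inE => /negPf ->.
Qed.

(** Left translation by [g] carries a decomposition of [t] to one of [r * t]; uniqueness does the
    rest. *)
Lemma proj_mul g h r t :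
  gr g r -> proj (g * h)%g (r * t) = r * proj h t.
Proof.
move=> rg; have [s [us _ t0 et]] := projP t.
rewrite (@proj_eq _ [seq (g * i)%g | i <- s]
           (fun i => r * proj (g^-1 * i)%g t)) ?mulKg //.
split.
- by rewrite map_inj_uniq //; exact: mulgI.
- move=> i; have := component_mul rg (proj_component (g^-1 * i)%g t).
  by rewrite mulVKg.
- move=> i si; rewrite t0 ?mulr0 //; apply: contra si => si.
  by apply/mapP; exists (g^-1 * i)%g; rewrite ?mulVKg.
- rewrite big_map [in LHS]et mulr_sumr.
  by apply: eq_bigr => i _; rewrite mulKg.
Qed.

(** Independence is inherited from [R], and by uniqueness a decomposition inside [I] is the one in
    [R]. *)
Lemma graded_idealP (I : set R) :
  is_graded_ideal gr I <-> is_ideal I /\ forall g r, I r -> I (proj g r).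
Proof.
split=> [[Ii [dec _]]|[Ii Ip]]; split=> //.
  move=> g r /dec[s [x [us xP er]]].
  have [I0 _ _] := (is_idealP I).1 Ii.
  (* Nothing is known of [x] off [s], hence the truncation by 0. *)
  rewrite (@proj_eq _ s (fun i => if i \in s then x i else 0)).
    by case: ifP => // /xP[].
  split=> // [i|i /negPf->//|].
    by case: ifP => [/xP[] //|_]; exact: component0.
  by rewrite er; apply: eq_big_seq => i ->.
split=> [r|s x us xP].
  split=> [Ir|[s [x [us xP ->]]]].
    have [s [us xP _ er]] := projP r; exists s, (proj^~ r).
    by split=> // i _; split; [exact: Ip|exact: xP].
  by rewrite big_seq; apply: ideal_sum => // i /xP[].
by apply: (component_sum gr).2 => // i /xP[].
Qed.

End Projections.

(** * Contraction to R_e and the extension E *)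

Section ExtensionContraction.
Variables (G : groupType) (R : comPzRingType) (gr : grading G R).
Local Notation Re := (identity_subring gr).
Implicit Types (I : set Re) (J : set R).

Lemma identity_valP (a : Re) : gr 1%g (\val a).
Proof. exact: set_mem (valP a). Qed.

Definition proj1 (r : R) : Re :=
  IdentitySubring (mem_set (proj_component gr 1%g r)).

Lemma val_proj1 r : \val (proj1 r) = proj gr 1%g r.
Proof. by []. Qed.

Lemma proj1_val (a : Re) : proj1 (\val a) = a.
Proof.
by apply: val_inj; rewrite val_proj1 proj_id //; exact: identity_valP.
Qed.

Lemma proj1B r t : proj1 (r - t) = proj1 r - proj1 t.
Proof. by apply: val_inj; rewrite raddfB /= projB. Qed.

Lemma proj1_0 : proj1 0 = 0.
Proof. by rewrite -[0 in LHS](subrr 0) proj1B subrr. Qed.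

Lemma proj1_valM (a : Re) r : proj1 (\val a * r) = a * proj1 r.
Proof.
apply: val_inj; rewrite rmorphM !val_proj1 -{1}[1%g]mulg1 proj_mul //.
exact: identity_valP.
Qed.

Lemma val_proj1_mul g r t :
  gr g r -> \val (proj1 (r * t)) = r * proj gr g^-1%g t.
Proof. by move=> rg; rewrite val_proj1 -(mulgV g) proj_mul. Qed.

Definition contraction J : set Re := \val @^-1` J.
Definition extension I : set R := [set r | forall t, I (proj1 (r * t))].

Lemma contractionE J a : contraction J a = J (\val a).
Proof. by []. Qed.

Lemma contraction_ideal J : is_ideal J -> is_ideal (contraction J).
Proof.
case/is_idealP=> J0 JB JM; apply/is_idealP; split=> [|x y|a x].
- by rewrite !contractionE raddf0.
- by rewrite !contractionE raddfB; exact: JB.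
- by rewrite !contractionE rmorphM; exact: JM.
Qed.

(** Stability under components comes from (r_g t)_e = r_g t_{g^-1} = (r t_{g^-1})_e. *)
Lemma extension_graded I : is_ideal I -> is_graded_ideal gr (extension I).
Proof.
case/is_idealP=> I0 IB IM; apply/graded_idealP; split.
  apply/is_idealP; split=> [t|x y xI yI t|a x xI t].
  - by rewrite mul0r proj1_0.
  - by rewrite mulrBl proj1B; apply: IB.
  - by rewrite [a * x]mulrC -mulrA; exact: xI.
move=> g r rI t.
suff -> : proj1 (proj gr g r * t) = proj1 (r * proj gr g^-1%g t) by exact: rI.
apply: val_inj; rewrite (val_proj1_mul _ (proj_component gr g r)) [r * _]mulrC.
rewrite (val_proj1_mul _ (proj_component gr g^-1%g t)) invgK.
exact: mulrC.
Qed.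

(** One inclusion tests with t = 1; the other is the R_e-linearity of [proj1]. *)
Lemma extensionK I : is_ideal I -> contraction (extension I) = I.
Proof.
case/is_idealP=> _ _ IM; apply/seteqP; split=> a.
  by move/(_ 1); rewrite mulr1 proj1_val.
by move=> Ia t; rewrite proj1_valM mulrC; exact: IM.
Qed.

(** From right to left: for r in J, the ideal J contains r t and, being graded, also (r t)_e. *)
Lemma sub_extension I J :
  is_ideal I -> is_graded_ideal gr J ->
  J `<=` extension I <-> contraction J `<=` I.
Proof.
move=> Ii /graded_idealP[/is_idealP[_ _ JM] Jp]; split=> [JI a Ja|JI r Jr t].
  by rewrite -(extensionK Ii); exact: JI.
by apply: JI; rewrite contractionE val_proj1; apply: Jp; rewrite mulrC;
  exact: JM.
Qed.

Lemma extensionS I I' : I `<=` I' -> extension I `<=` extension I'.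
Proof. by move=> II' r rI t; exact/II'. Qed.

Lemma contraction_proper J :
  is_ideal J -> J <> [set: R] -> contraction J <> [set: Re].
Proof.
move=> Ji; rewrite (ideal_properP Ji) => J1.
apply/(ideal_properP (contraction_ideal Ji)).
by rewrite !contractionE rmorph1.
Qed.

Lemma extension_proper I :
  is_ideal I -> I <> [set: Re] -> extension I <> [set: R].
Proof. by move=> Ii In eT; apply: In; rewrite -(extensionK Ii) eT. Qed.

Lemma contraction_prime P :
  is_homogeneous_prime_ideal gr P -> is_prime_ideal (contraction P).
Proof.
case=> -[Pi _] Pn Pm; split; first exact: contraction_ideal.
  exact: contraction_proper.
move=> x y; rewrite !contractionE rmorphM.
by apply: Pm; exists 1%g => //; exact: identity_valP.
Qed.

Lemma extension_prime P :
  is_prime_ideal P -> is_homogeneous_prime_ideal gr (extension P).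
Proof.
case=> Pi Pn Pm; split; first exact: extension_graded.
  exact: extension_proper.
move=> r s [g _ rg] [h _ sh] rsP; apply: contrapT => /not_orP[].
move=> /existsNP[t rt] /existsNP[u su].
(* Here [t] and [u] witness that [r] and [s] lie outside E(P). The product of the two e-components
   is r s t_{g^-1} u_{h^-1}, which already lies in R_e, so rs in E(P) puts it in P. *)
suff /Pm[] : P (proj1 (r * t) * proj1 (s * u)) by [].
suff -> : proj1 (r * t) * proj1 (s * u) =
    proj1 (r * s * (proj gr g^-1%g t * proj gr h^-1%g u)) by exact: rsP.
rewrite mulrACA -(val_proj1_mul _ rg) proj1_valM; congr (_ * _).
by apply: val_inj; rewrite -(val_proj1_mul _ sh) proj1_val.
Qed.

Lemma contraction_maximal M :
  is_graded_maximal_ideal gr M ->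
  is_maximal_ideal (contraction M) /\ extension (contraction M) = M.
Proof.
case=> Mg Mn Mmax; have Mi := Mg.1; have Ci := contraction_ideal Mi.
(* Used twice: contracting E(I) = M gives maximality of the contraction, and taking I to be the
   contraction itself gives the second claim. *)
have maxE I : is_ideal I -> I <> [set: Re] -> contraction M `<=` I ->
    extension I = M.
  move=> Ii In CI; apply: Mmax; first exact: extension_graded.
    exact: extension_proper.
  exact/sub_extension.
have Cn := contraction_proper Mi Mn.
split; last exact: maxE.
by split=> // I Ii In CI; rewrite -(maxE I) // extensionK.
Qed.

Lemma extension_maximal M :
  is_maximal_ideal M -> is_graded_maximal_ideal gr (extension M).
Proof.
case=> Mi Mn Mmax; split; first exact: extension_graded.
  exact: extension_proper.
(* It remains to see that J contracts into [M]; its contraction is a proper ideal above [M], hence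
   equal to it. *)
move=> J Jg Jn MJ; apply/seteqP; split=> //; apply/sub_extension => //.
rewrite (Mmax (contraction J)) //; first exact: contraction_ideal Jg.1.
  exact: contraction_proper Jg.1 Jn.
by rewrite -[M](extensionK Mi) => a; exact: MJ.
Qed.

End ExtensionContraction.

Theorem corollary2p15 (G : groupType) (R : comPzRingType) (gr : grading G R) :
  gelfand_graded_ring gr <-> gelfand_ring (identity_subring gr).
Proof.
split=> gelf P Pp.
  have [M [[Mm PM] Mu]] := gelf _ (extension_prime Pp).
  have Pi : is_ideal P by case: Pp.
  exists (contraction M); split=> [|N [Nm PN]].
    split; first exact: (contraction_maximal Mm).1.
    by rewrite -(extensionK Pi) => a; exact: PM.
  have Ni : is_ideal N by case: Nm.
  (* Uniqueness upstairs forces M = E(N), and contracting gives back N. *)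
  rewrite (Mu (extension N)) ?extensionK //; split.
    exact: extension_maximal.
  exact: extensionS.
have [M [[Mm PM] Mu]] := gelf _ (contraction_prime Pp).
have Pg : is_graded_ideal gr P by case: Pp.
have Mi : is_ideal M by case: Mm.
exists (extension M); split=> [|N [Nm PN]].
  by split; [exact: extension_maximal|exact/sub_extension].
(* N is the extension of its contraction, so uniqueness in R_e suffices. *)
have [Cm <-] := contraction_maximal Nm.
by rewrite (Mu (contraction N)) //; split=> // a; exact: PN.
Qed.
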